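(* For every integer $N>1$ and every real $\sigma>1$, $\zeta_N(\sigma)>\zeta(\sigma)$, where $\zeta$ is the Riemann zeta function.
   Context: For an integer $M\ge0$, $T_M(x)=\sum_{k=0}^{M}\frac{x^k}{k!}$. For an integer $N\ge1$ and $\Re(s)>1$, $\zeta_N(s)=\frac{1}{\Gamma(s+N-1)}\int_0^\infty \frac{x^{s+N-2}}{e^x-T_{N-1}(x)}\,dx$. *)

(* Defs.v *)
From HB Require Import structures.
From mathcomp Require Export all_boot all_order all_algebra.
From mathcomp Require Export all_classical all_reals all_analysis.

Set Implicit Arguments.
Unset Strict Implicit.
Unset Printing Implicit Defensive.

Export Order.TTheory GRing.Theory Num.Theory.
Export numFieldNormedType.Exports.

Local Open Scope classical_set_scope.
Local Open Scope ring_scope.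

(* All integrals are real-valued Lebesgue integrals over the open half-line.
   [Rintegral] and [limn] return a default value when the integral or the
   series diverges; the stated domains are those where they converge. *)

(* Euler's integral, meaningful for 0 < s. *)
Definition Gamma {R : realType} (s : R) : R :=
  \int[lebesgue_measure]_(x in `]0, +oo[) (x `^ (s - 1) * expR (- x)).

(* The Dirichlet series of the Riemann zeta function on the real half-line
   1 < s; the term of index n is 1 / (n + 1)^s. *)
Definition zeta {R : realType} (s : R) : R :=
  limn (series (fun n : nat => (n.+1%:R `^ s)^-1)).

Definition taylor_exp {R : realType} (M : nat) (x : R) : R :=
  \sum_(0 <= k < M.+1) x ^+ k / k`!%:R.

(* Restricted to real s; meaningful for 1 <= N and 1 < s. *)
Definition hyper_zeta {R : realType} (N : nat) (s : R) : R :=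
  (Gamma (s + N%:R - 1))^-1 *
  \int[lebesgue_measure]_(x in `]0, +oo[)
     (x `^ (s + N%:R - 2) / (expR x - taylor_exp N.-1 x)).

(* Main.v *)
Require Import Defs.
From mathcomp Require Import ring lra measurable_realfun.

(** Write [exp_tail n x = e^x - T_(n-1)(x)] and
    [mellin c n = \int_0^oo x^(c-1) / exp_tail n x dx], so that
    [Gamma c = mellin c 0] and
    [zeta_N(s) = mellin (s+N-1) N / mellin (s+N-1) 0].  For [N = 2], the series
    [\sum_k k e^(-k x)] equals [e^x / (e^x - 1)^2 < 1 / exp_tail 2 x]; integrated
    against [x^s], this reads [zeta(s) Gamma(s+1) < mellin (s+1) 2].  For the
    step from [N] to [N+1], log-concavity of [n |-> exp_tail n x] says that
    [- (1 / exp_tail n)' <= 1 / exp_tail (n+1)], whence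
    [c * mellin c n <= mellin (c+1) (n+1)], while
    [Gamma (c+1) <= c * Gamma c].  Instead of integrating by parts, both
    inequalities compare an integrand with its dilate by [e^t] and let [t] tend
    to 0. *)

Set Implicit Arguments.
Unset Strict Implicit.
Unset Printing Implicit Defensive.

Local Open Scope classical_set_scope.
Local Open Scope ring_scope.

(** * Taylor remainders of the exponential *)

Section exp_tail.
Context {R : realType}.
Implicit Types (x y : R) (n m : nat).

Lemma ler_of_derive_ge0 (f f' : R -> R) (a b : R) : a <= b ->
  (forall x, is_derive x 1 f (f' x)) -> (forall x, a < x < b -> 0 <= f' x) ->
  f a <= f b.
Proof.
rewrite le_eqVlt => /predU1P[->//|ab] df f'0.
have [c cab fba] := MVT ab (fun x _ => df x)
  (continuous_subspaceT (fun x => differentiable_continuous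
    (iffLR (@derivable1_diffP _ _ _ _) (@ex_derive _ _ _ _ _ _ _ (df x))))).
rewrite -subr_ge0 fba mulr_ge0 ?subr_ge0 ?(ltW ab)//.
by apply: f'0; move: cab; rewrite in_itv.
Qed.

Definition exp_term n x : R := x ^+ n / n`!%:R.

Definition exp_tail n x : R := expR x - \sum_(0 <= k < n) exp_term k x.

Lemma exp_tail0 x : exp_tail 0 x = expR x.
Proof. by rewrite /exp_tail big_nil subr0. Qed.

Lemma exp_tailE n x : exp_tail n x = exp_term n x + exp_tail n.+1 x.
Proof. rewrite /exp_tail big_nat_recr//=; ring. Qed.

Lemma exp_tailS0 n : exp_tail n.+1 0 = 0.
Proof.
rewrite /exp_tail big_nat_recl//= big1 => [|i _].
  by rewrite /exp_term expr0 fact0 expR0; lra.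
by rewrite /exp_term exprS !mul0r.
Qed.

Lemma exp_termSn n x : n.+1%:R * exp_term n.+1 x = x * exp_term n x.
Proof.
rewrite /exp_term exprS factS natrM.
by field; rewrite nat1r !pnatr_eq0 -lt0n fact_gt0.
Qed.

Lemma is_derive_exp_termS n x : is_derive x 1 (exp_term n.+1) (exp_term n x).
Proof.
rewrite (_ : exp_term n.+1 = (n.+1`!%:R)^-1 *: (id ^+ n.+1)); last first.
  by apply: funext => y; rewrite /exp_term !fctE mulrC.
apply: is_derive_eq; rewrite /exp_term factS natrM /=.
rewrite /GRing.scale/=.
by field; rewrite ?nat1r !pnatr_eq0 -lt0n fact_gt0.
Qed.

Lemma is_derive_exp_tailS n x : is_derive x 1 (exp_tail n.+1) (exp_tail n x).
Proof.
elim: n => [|n IH].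
  rewrite (_ : exp_tail 1 = expR - cst 1); last first.
    by apply: funext => y; rewrite /exp_tail big_nat1 /exp_term expr0 fact0 divr1.
  by rewrite exp_tail0; apply: is_derive_eq; rewrite subr0.
rewrite (_ : exp_tail n.+2 = exp_tail n.+1 - exp_term n.+1); last first.
  by apply: funext => y; rewrite !fctE [in RHS]exp_tailE; ring.
have H := is_derive_exp_termS n x.
by apply: is_derive_eq; rewrite exp_tailE; ring.
Qed.

Lemma is_derive_exp_tail0 x : is_derive x 1 (exp_tail 0) (exp_tail 0 x).
Proof.
have -> : exp_tail 0 = expR by apply: funext => y; rewrite exp_tail0.
exact: is_derive_expR.
Qed.

Lemma continuous_exp_tail n : continuous (exp_tail n).
Proof.
move=> x; apply/differentiable_continuous/derivable1_diffP.
by case: n => [|n]; [case: (is_derive_exp_tail0 x)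
                    |case: (is_derive_exp_tailS n x)].
Qed.

Lemma exp_term_ge0 n x : 0 <= x -> 0 <= exp_term n x.
Proof. by move=> x0; rewrite divr_ge0 ?exprn_ge0. Qed.

Lemma exp_term_gt0 n x : 0 < x -> 0 < exp_term n x.
Proof. by move=> x0; rewrite divr_gt0 ?exprn_gt0// ltr0n fact_gt0. Qed.

Lemma exp_tail_ge0 n x : 0 <= x -> 0 <= exp_tail n x.
Proof.
elim: n x => [|n IH] x x0; first by rewrite exp_tail0 expR_ge0.
rewrite -(exp_tailS0 n); apply: (ler_of_derive_ge0 x0 (is_derive_exp_tailS n)).
by move=> y /andP[/ltW y0 _]; exact: IH.
Qed.

Lemma exp_tail_le n m x : (n <= m)%N -> 0 <= x -> exp_tail m x <= exp_tail n x.
Proof.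
move=> /subnK <- x0; elim: (m - n)%N => [//|k]; apply: le_trans.
by rewrite (exp_tailE (k + n)) lerDr exp_term_ge0.
Qed.

(** The remainder dominates every monomial of degree at least [n]: degree [n] itself serves near 0,
    large degrees serve at infinity. *)
Lemma exp_term_le_tail n m x : (n <= m)%N -> 0 <= x ->
  exp_term m x <= exp_tail n x.
Proof.
move=> nm x0; apply: le_trans (exp_tail_le nm x0).
by rewrite exp_tailE lerDl exp_tail_ge0.
Qed.

Lemma exp_tail_gt0 n x : 0 < x -> 0 < exp_tail n x.
Proof.
by move=> x0; apply: lt_le_trans (exp_term_le_tail (leqnn n) (ltW x0));
  exact: exp_term_gt0.
Qed.

Lemma ler_exp_tail n x y : 0 <= x -> x <= y -> exp_tail n x <= exp_tail n y.
Proof.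
case: n => [|n] x0 xy; first by rewrite !exp_tail0 ler_expR.
apply: (ler_of_derive_ge0 xy (is_derive_exp_tailS n)) => z /andP[xz _].
by apply: exp_tail_ge0; lra.
Qed.

(* The left-hand side minus the right-hand side has the same expression with
   [n.+1] replaced by [n] as its derivative. *)
Lemma exp_tail_le_term n x : 0 <= x ->
  (n%:R - 1 - x) * exp_tail n x <= n%:R * exp_term n x.
Proof.
elim: n x => [|n IH] x x0.
  by rewrite exp_tail0; have := mulr_ge0 x0 (expR_ge0 x); have := expR_ge0 x; lra.
pose L (y : R) := n.+1%:R * exp_term n.+1 y - (n%:R - y) * exp_tail n.+1 y.
have dL y : is_derive y 1 L (n%:R * exp_term n y - (n%:R - 1 - y) * exp_tail n y).
  have H1 := is_derive_exp_termS n y; have H2 := is_derive_exp_tailS n y.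
  rewrite (_ : L = n.+1%:R *: exp_term n.+1 -
                   ((cst n%:R - id) * exp_tail n.+1)); last by apply: funext.
  apply: is_derive_eq; rewrite !fctE /GRing.scale/= exp_tailE -natr1; ring.
rewrite -natr1 addrK -subr_ge0.
rewrite (_ : 0 = L 0); last first.
  by rewrite /L exp_tailS0 /exp_term exprS; ring.
rewrite natr1; apply: (ler_of_derive_ge0 x0 dL) => y /andP[/ltW y0 _].
by rewrite subr_ge0 IH.
Qed.

(** With [u], [v] the terms of index [n], [n.+1] and [w = exp_tail n.+2 x], the claim is
    [(u + v + w) * w <= (v + w) ^+ 2]. Since [n.+1%:R * v = x * u], the difference times [n.+1%:R]
    equals [u * (x * v - (n.+1%:R - x) * w)], and [exp_tail_le_term] at index [n.+2] makes the
    second factor nonnegative. *)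
Lemma exp_tail_log_concave n x : 0 < x ->
  exp_tail n x * exp_tail n.+2 x <= exp_tail n.+1 x ^+ 2.
Proof.
move=> x0; have := exp_tail_le_term n.+2 (ltW x0); rewrite exp_termSn.
rewrite (exp_tailE n) (exp_tailE n.+1) -[n.+2%:R]natr1 addrK.
have := exp_termSn n x; have := exp_term_gt0 n x0.
set u := exp_term n x; set v := exp_term n.+1 x; set w := exp_tail n.+2 x.
move=> u0 uv H; have n0 : 0 < n.+1%:R :> R by rewrite ltr0n.
rewrite -(ler_pM2r n0) -subr_ge0.
(* The last two summands cancel once [u * x] is replaced by [n.+1%:R * v]. *)
rewrite (_ : _ - _ = u * (x * v - (n.+1%:R - x) * w)
    + (v ^+ 2 + v * w) * n.+1%:R - u * x * (v + w)); last by ring.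
rewrite [u * x]mulrC -uv.
have := mulr_ge0 (ltW u0) (_ : 0 <= x * v - (n.+1%:R - x) * w).
rewrite subr_ge0 => /(_ H); set t := _ * (_ - _); move=> t0.
by rewrite (_ : _ - _ = t)//; ring.
Qed.

(** By the mean value theorem the left side is [x - y] times [exp_tail n z / exp_tail n.+1 z ^+ 2]
    for some [z] between [y] and [x]. Log-concavity bounds this quotient by [(exp_tail n.+2 z)^-1],
    which is largest at the left end [y]. *)
Lemma inv_exp_tail_sub_le n x y : 0 < y -> y < x ->
  (exp_tail n.+1 y)^-1 - (exp_tail n.+1 x)^-1 <= (x - y) / exp_tail n.+2 y.
Proof.
move=> y0 yx.
have p n' z : y <= z -> 0 < exp_tail n' z by move=> ?; apply: exp_tail_gt0; lra.
have dF z : z \in `]y, x[%R -> is_derive z 1 (fun z => (exp_tail n.+1 z)^-1)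
    (- (exp_tail n z / exp_tail n.+1 z ^+ 2)).
  rewrite in_itv/= => /andP[yz _]; have H := is_derive_exp_tailS n z.
  have T0 : exp_tail n.+1 z != 0 by rewrite gt_eqF// p// ltW.
  by apply: is_derive_eq; rewrite /GRing.scale/=; field.
have cF : {within `[y, x], continuous (fun z => (exp_tail n.+1 z)^-1)}.
  apply: continuous_in_subspaceT => z /set_mem/=; rewrite in_itv/= => /andP[yz _].
  by apply: continuousV; [rewrite gt_eqF// p|exact: continuous_exp_tail].
have [z] := MVT yx dF cF; rewrite in_itv/= => /andP[yz zx] E.
rewrite -opprB E mulNr opprK mulrC ler_wpM2l ?subr_ge0 ?(ltW yx)//.
apply: (@le_trans _ _ (exp_tail n.+2 z)^-1).
  rewrite ler_pdivrMr ?exprn_gt0 ?p ?(ltW yz)// mulrC ler_pdivlMr ?p ?(ltW yz)//.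
  by apply: exp_tail_log_concave; lra.
by rewrite lef_pV2 ?posrE ?p ?(ltW yz)// ler_exp_tail// ltW.
Qed.

(** The right side is [expR (- x) * (expR (x - y) - 1)]. This is the reverse estimate, at index 0,
    that the bound on [Gamma (c + 1)] requires. *)
Lemma expRN_sub_ge (x y : R) : (x - y) * expR (- x) <= expR (- y) - expR (- x).
Proof.
have -> : - y = (x - y) + - x by ring.
rewrite expRD; have := expR_ge1Dx (x - y); have := expR_gt0 (- x); nra.
Qed.

End exp_tail.

(** * Dilations and positivity for integrals over the half-line *)

Section half_line.
Context {R : realType}.
Local Notation mu := (@lebesgue_measure R).
Local Notation D := (`]0, +oo[%classic : set R).
Implicit Types (f g : R -> R) (l : R).

(** Uniqueness of Lebesgue measure: [l] times the image measure agrees with [mu] on the half-open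
    intervals. *)
Lemma lebesgue_measure_dilation l (A : set R) : 0 < l -> measurable A ->
  (pushforward mu ( *%R l : _ -> measurableTypeR R) A = (l^-1)%:E * mu A)%E.
Proof.
move=> l0 mA; have li0 : 0 <= l^-1 by rewrite invr_ge0 ltW.
have mphi : measurable_fun setT ( *%R l : _ -> measurableTypeR R).
  exact: mulrl_measurable.
have l0' : 0 <= l by exact: ltW.
pose phi_mu : {measure set (measurableTypeR R) -> \bar R} :=
  mscale (NngNum l0')
    (measure_function_pushforward__canonical__measure_function_Measure mu mphi).
suff -> : mu A = phi_mu A.
  by rewrite /phi_mu/= /mscale/= muleA -EFinM mulVf ?mul1e// gt_eqF.
apply: (lebesgue_measure_unique (mu:=phi_mu)) => //= _ [[a b]] _ <-.
rewrite /phi_mu/= /mscale/= /pushforward.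
have -> : *%R l @^-1` `]a, b] = `]a / l, b / l]%classic.
  apply/seteqP; split => x /=; rewrite !in_itv/= ltr_pdivrMr// ler_pdivlMr//;
    by rewrite [x * l]mulrC.
rewrite !lebesgue_measure_itv/= !lte_fin ltr_pM2r ?invr_gt0//.
case: ifP => _; rewrite ?mule0// -!EFinB -EFinM; congr _%:E.
by field; rewrite gt_eqF.
Qed.

(** Change of variables through the image measure, [D] being its own preimage under a dilation. The
    extended-real form assumes no integrability, so it also yields that of the dilate. *)
Lemma ge0_integral_dilation l f : 0 < l -> measurable_fun D f ->
  (forall x, 0 < x -> 0 <= f x) ->
  (\int[mu]_(x in D) (f (l * x))%:E = (l^-1)%:E * \int[mu]_(x in D) (f x)%:E)%E.
Proof.
move=> l0 mf f0; have li0 : 0 <= l^-1 by rewrite invr_ge0 ltW.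
have mphi : measurable_fun setT ( *%R l : _ -> measurableTypeR R).
  exact: mulrl_measurable.
have f0' x : D x -> (0 <= (f x)%:E)%E by rewrite /= in_itv/= andbT lee_fin => /f0.
have {1}-> : D = ( *%R l : _ -> measurableTypeR R) @^-1` D.
  by apply/seteqP; split => x /=; rewrite !in_itv/= !andbT pmulr_rgt0.
rewrite -(@ge0_integral_pushforward _ _ (measurableTypeR R) _ _ _ mphi mu D
  (EFin \o f))//=; last 2 first.
- exact/measurable_EFinP.
- by move=> y /set_mem; exact: f0'.
rewrite (@eq_measure_integral _ _ _ _ (mscale (NngNum li0) mu)); last first.
  by move=> A mA _; rewrite /mscale/= lebesgue_measure_dilation.
rewrite ge0_integral_mscale//.
exact/measurable_EFinP.
Qed.

Lemma integral_abs_half_line f : (forall x, 0 < x -> 0 <= f x) ->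
  (\int[mu]_(x in D) `|(EFin \o f) x| = \int[mu]_(x in D) (f x)%:E)%E.
Proof.
move=> f0; apply: eq_integral => x /set_mem/=; rewrite in_itv/= andbT => x0.
by rewrite ger0_norm// f0.
Qed.

Lemma measurable_dilation l f : 0 < l -> measurable_fun D f ->
  measurable_fun D (fun x => f (l * x)).
Proof.
move=> l0 mf; apply: (@measurable_comp _ _ _ _ _ _ D) => //.
  by move=> y [x /= + <-]; rewrite !in_itv/= !andbT => x0; rewrite mulr_gt0.
Qed.

Lemma integrable_dilation l f : 0 < l -> (forall x, 0 < x -> 0 <= f x) ->
  mu.-integrable D (EFin \o f) -> mu.-integrable D (EFin \o (fun x => f (l * x))).
Proof.
move=> l0 f0 /integrableP[/measurable_EFinP mf foo]; apply/integrableP; split.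
  by apply/measurable_EFinP; exact: measurable_dilation.
rewrite integral_abs_half_line => [|x x0]; last by rewrite f0// mulr_gt0.
rewrite ge0_integral_dilation// lte_mul_pinfty ?lee_fin ?invr_ge0 ?(ltW l0)//.
by rewrite -integral_abs_half_line.
Qed.

Lemma Rintegral_dilation l f : 0 < l -> (forall x, 0 < x -> 0 <= f x) ->
  mu.-integrable D (EFin \o f) ->
  \int[mu]_(x in D) f (l * x) = l^-1 * \int[mu]_(x in D) f x.
Proof.
move=> l0 f0 If; rewrite /Rintegral ge0_integral_dilation//.
  by rewrite fineM//; exact: integrable_fin_num.
by case/integrableP: If => /measurable_EFinP.
Qed.

(** A zero integral would make [f] vanish almost everywhere on [D]; as [f] vanishes nowhere there,
    [D] would be a null set. *)
Lemma Rintegral_gt0 f : mu.-integrable D (EFin \o f) ->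
  (forall x, 0 < x -> 0 < f x) -> 0 < \int[mu]_(x in D) f x.
Proof.
move=> If f0; have f0' x : D x -> 0 <= f x.
  by rewrite /= in_itv/= andbT => /f0/ltW.
rewrite lt_neqAle Rintegral_ge0// andbT; apply/negP => /eqP E.
have : (\int[mu]_(x in D) `|(EFin \o f) x| = 0)%E.
  rewrite integral_abs_half_line => [|x /f0/ltW//].
  by rewrite -[LHS]fineK ?integrable_fin_num//; congr _%:E.
have [mf _] := integrableP _ _ _ If.
move=> /(ae_eq_integral_abs mu _ mf) => /(_ (measurable_itv _)).
move=> [A [mA A0 DA]]; suff : (mu D <= 0)%E.
  by rewrite lebesgue_measure_itv/= ltry.
rewrite -A0; apply: le_measure; rewrite ?inE//.
move=> x Dx; apply: DA => /= /(_ Dx) [] fx0.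
by move: Dx; rewrite /= in_itv/= andbT => /f0; rewrite fx0 ltxx.
Qed.

End half_line.

(** * Convergence of the Mellin integrals *)

Section mellin.
Context {R : realType}.
Local Notation mu := (@lebesgue_measure R).
Local Notation D := (`]0, +oo[%classic : set R).
Implicit Types (b c x y l : R) (n m : nat).

Lemma continuous_powR b x : 0 < x -> {for x, continuous (@powR R ^~ b)}.
Proof.
move=> x0; apply/differentiable_continuous/derivable1_diffP.
by apply: derivable_powR; rewrite in_itv/= andbT.
Qed.

(* A dominating function with an elementary primitive, of order [x `^ (b - 1)]
   at 0 and [x `^ (- b - 1)] at infinity. *)
Definition beta_weight b x : R := x `^ (b - 1) / (1 + x `^ b) ^+ 2.

Lemma powRD1_gt0 b x : 0 < 1 + x `^ b.
Proof. by rewrite ltr_wpDr// powR_ge0. Qed.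

Lemma beta_weight_ge0 b x : 0 <= beta_weight b x.
Proof. by rewrite divr_ge0 ?powR_ge0// exprn_ge0// ltW// powRD1_gt0. Qed.

Lemma continuous_beta_weight b x : 0 < x -> {for x, continuous (beta_weight b)}.
Proof.
move=> x0; apply: continuousM; first exact: continuous_powR.
apply: continuousV; first by rewrite gt_eqF// exprn_gt0// powRD1_gt0.
have H : {for x, continuous (fun y => 1 + y `^ b)}.
  by apply: continuousD; [exact: cst_continuous|exact: continuous_powR].
exact: (continuousM H H).
Qed.

Lemma measurable_continuous_half_line (f : R -> R) :
  (forall x, 0 < x -> {for x, continuous f}) -> measurable_fun D f.
Proof.
move=> cf; apply: open_continuous_measurable_fun; first exact: interval_open.
by move=> x; rewrite inE/= in_itv/= andbT => /cf.
Qed.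

Lemma is_derive_beta_primitive b x : 0 < b -> 0 < x ->
  is_derive x 1 (fun y => - (b * (1 + y `^ b))^-1) (beta_weight b x).
Proof.
move=> b0 x0; have H := is_derive1_powR b x0.
have p := powRD1_gt0 b x.
have H0 : b * (1 + x `^ b) != 0 by rewrite mulf_neq0// gt_eqF.
have H1 : is_derive x 1 (fun y => b * (1 + y `^ b)) (b * (b * x `^ (b - 1))).
  have -> : (fun y : R => b * (1 + y `^ b)) =
    b *: (cst 1 + (@powR R ^~ b : R -> R)) by [].
  by apply: is_derive_eq; rewrite add0r.
apply: is_derive_eq; rewrite /beta_weight/GRing.scale/=.
by field; rewrite !gt_eqF.
Qed.

(** The bound does not depend on [u] and [v], so it persists when the intervals exhaust the
    half-line. *)
Lemma integral_beta_weight_itv b u v : 0 < b -> 0 < u -> u < v ->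
  (\int[mu]_(x in `[u, v]) (beta_weight b x)%:E <= (b^-1)%:E)%E.
Proof.
move=> b0 u0 uv.
have dF x : u <= x ->
    is_derive x 1 (fun y => - (b * (1 + y `^ b))^-1) (beta_weight b x).
  by move=> ux; apply: is_derive_beta_primitive => //; lra.
have cF x : u <= x -> {for x, continuous (fun y => - (b * (1 + y `^ b))^-1)}.
  by move=> ux; apply/differentiable_continuous/derivable1_diffP; case: (dF _ ux).
rewrite (continuous_FTC2 uv (F := fun y => - (b * (1 + y `^ b))^-1)).
- rewrite -EFinB lee_fin opprK addrC.
  apply: (@le_trans _ _ (b * (1 + u `^ b))^-1).
    by rewrite gerDl oppr_le0 invr_ge0 mulr_ge0 ?(ltW b0)// ltW// powRD1_gt0.
  rewrite lef_pV2 ?posrE ?mulr_gt0 ?powRD1_gt0// ler_peMr ?(ltW b0)//.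
  by rewrite lerDl powR_ge0.
- apply: continuous_in_subspaceT => x /set_mem/=; rewrite in_itv/= => /andP[ux _].
  by apply: continuous_beta_weight; lra.
- split.
  + by move=> x; rewrite in_itv/= => /andP[/ltW/dF[]].
  + by apply: cvg_at_right_filter; exact: cF.
  + by apply: cvg_at_left_filter; apply: cF; exact: ltW.
- move=> x; rewrite in_itv/= => /andP[/ltW ux _].
  by rewrite derive1E; have [_ ->] := dF _ ux.
Qed.

Lemma integrable_beta_weight b : 0 < b ->
  mu.-integrable D (EFin \o beta_weight b).
Proof.
move=> b0.
have mw : measurable_fun D (EFin \o beta_weight b).
  apply/measurable_EFinP; apply: measurable_continuous_half_line => x.
  exact: continuous_beta_weight.
apply/integrableP; split=> //.
rewrite integral_abs_half_line => [|x _]; last exact: beta_weight_ge0.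
(* Starting at 2 keeps the left end strictly below the right end, also for [n = 0]; monotone
   convergence along [F] then gives the integral over [D]. *)
pose F n : set R := `[n.+2%:R^-1, n.+2%:R]%classic.
have FD n : F n `<=` D.
  move=> x; rewrite /F/= !in_itv/= andbT => /andP[+ _]; apply: lt_le_trans.
  by rewrite invr_gt0.
have DF : D = \bigcup_n F n.
  apply/seteqP; split => [x|x [n _ /FD//]].
  rewrite /= in_itv/= andbT => x0.
  pose n := maxn (Num.truncn x) (Num.truncn x^-1).
  have H y : 0 < y -> (Num.truncn y <= n)%N -> y <= n.+2%:R.
    move=> y0 yn; apply: (@le_trans _ _ (Num.truncn y).+1%:R).
      exact/ltW/truncnS_gt.
    by rewrite ler_nat ltnW// !ltnS.
  exists n => //; rewrite /F/= in_itv/= H ?leq_maxl// andbT.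
  by rewrite -[leRHS]invrK lef_pV2 ?posrE ?invr_gt0// H ?invr_gt0// leq_maxr.
have nF : nondecreasing_seq F.
  move=> m n mn; rewrite subsetEset => x; rewrite /F/= !in_itv/= => /andP[mx xm].
  apply/andP; split; last by rewrite (le_trans xm)// ler_nat !ltnS.
  by rewrite (le_trans _ mx)// lef_pV2 ?posrE// ler_nat !ltnS.
have mF n : measurable_fun (F n) (EFin \o beta_weight b).
  exact: measurable_funS (FD n) mw.
have := @ge0_nondecreasing_set_cvg_integral _ (measurableTypeR R) _ F _ mu nF
  (fun n => measurable_itv _) mF (fun _ x _ => beta_weight_ge0 b x).
rewrite -DF => cvgF; apply: le_lt_trans (ltry b^-1).
apply: cvge_le cvgF; apply: nearW => n; apply: integral_beta_weight_itv => //.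
by rewrite (@lt_trans _ _ 1)// ?invf_lt1// ltr1n.
Qed.

(** For [x <= 1] the square is at most 4, and the term of degree [n] suffices. For [x >= 1] it is at
    most [4 * x ^+ (k + k)] with [b <= k%:R], and the term of degree [m] suffices. The constant adds
    the two cases. *)
Lemma exp_tail_beta_bound b n : 0 < b -> exists2 C, 0 < C &
  forall x, 0 < x -> (1 + x `^ b) ^+ 2 * x ^+ n <= C * exp_tail n x.
Proof.
move=> b0; pose k := Num.bound b; pose m := (k + (k + n))%N.
have bk : b <= k%:R by apply/ltW/archi_boundP/ltW.
have fact0 p : 0 < p`!%:R :> R by rewrite ltr0n fact_gt0.
exists (4 * (n`!%:R + m`!%:R)); first by rewrite mulr_gt0 ?addr_gt0.
move=> x x0; have pb := powR_ge0 x b; have x0' := ltW x0.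
have le_tail p : (n <= p)%N -> x ^+ p <= p`!%:R * exp_tail n x.
  by move=> np; rewrite mulrC -ler_pdivrMr// exp_term_le_tail.
have t0 := exp_tail_ge0 n x0'.
have [x1|/ltW x1] := leP x 1.
  have pb1 : x `^ b <= 1 by rewrite -(powRr0 x) ger_powR ?x0 ?(ltW b0).
  apply: (@le_trans _ _ (4 * x ^+ n)).
    by rewrite ler_wpM2r ?exprn_ge0//; nra.
  rewrite -mulrA ler_wpM2l// mulrDl (le_trans (le_tail n _))// lerDl.
  by rewrite mulr_ge0 ?(ltW (fact0 _)).
have pbk : x `^ b <= x ^+ k by rewrite -powR_mulrn// ler_powR.
have pb1 : 1 <= x ^+ k by rewrite exprn_ege1.
apply: (@le_trans _ _ (4 * x ^+ m)).
  by rewrite /m !exprD !mulrA ler_wpM2r ?exprn_ge0//; nra.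
rewrite -mulrA ler_wpM2l// mulrDl (le_trans (le_tail m _))//.
  by rewrite /m addnA leq_addl.
by rewrite lerDr mulr_ge0 ?(ltW (fact0 _)).
Qed.

Definition mellin_integrand c n x : R := x `^ (c - 1) / exp_tail n x.

Definition mellin c n : R := \int[mu]_(x in D) mellin_integrand c n x.

Lemma mellin_integrand_gt0 c n x : 0 < x -> 0 < mellin_integrand c n x.
Proof. by move=> x0; rewrite divr_gt0 ?powR_gt0 ?exp_tail_gt0. Qed.

Lemma measurable_mellin_integrand c n : measurable_fun D (mellin_integrand c n).
Proof.
apply: measurable_continuous_half_line => x x0.
apply: continuousM; first exact: continuous_powR.
by apply: continuousV; [rewrite gt_eqF// exp_tail_gt0|exact: continuous_exp_tail].
Qed.

Lemma integrable_mellin c n : n%:R < c ->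
  mu.-integrable D (EFin \o mellin_integrand c n).
Proof.
move=> nc; pose b := c - n%:R; have b0 : 0 < b by rewrite subr_gt0.
have [C C0 HC] := exp_tail_beta_bound n b0.
apply: (@le_integrable _ (measurableTypeR R) R mu D (measurable_itv _)
  (EFin \o mellin_integrand c n) (EFin \o (fun x => C * beta_weight b x))) => //.
- by apply/measurable_EFinP; exact: measurable_mellin_integrand.
- move=> x /=; rewrite in_itv/= andbT => x0.
  rewrite lee_fin !ger0_norm ?(ltW (mellin_integrand_gt0 _ _ _))//; last first.
    by rewrite mulr_ge0 ?(ltW C0) ?beta_weight_ge0.
  rewrite /mellin_integrand /beta_weight ler_pdivrMr ?exp_tail_gt0//.
  have -> : c - 1 = (b - 1) + n%:R by rewrite /b; ring.
  rewrite (@powRD _ _ (b - 1)) ?(gt_eqF x0) ?implybT// powR_mulrn ?(ltW x0)//.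
  rewrite mulrCA -mulrA ler_wpM2l ?powR_ge0// mulrAC.
  rewrite ler_pdivlMr ?exprn_gt0 ?powRD1_gt0//.
  by rewrite mulrC; exact: HC.
rewrite (_ : EFin \o _ = (fun x => C%:E * (beta_weight b x)%:E)%E); last first.
  by apply: funext => x /=; rewrite EFinM.
apply: integrableZl => //; exact: integrable_beta_weight.
Qed.

End mellin.

(** * Raising the exponent by one, by dilation instead of integration by parts *)

Section mellin_shift.
Context {R : realType}.
Local Notation mu := (@lebesgue_measure R).
Local Notation D := (`]0, +oo[%classic : set R).
Implicit Types (c t x y l : R) (n m : nat).

Lemma Gamma_mellin c : Gamma c = mellin c 0.
Proof.
by apply: eq_Rintegral => x _; rewrite /mellin_integrand exp_tail0 expRN.
Qed.

Lemma mellin_ge0 c n : 0 <= mellin c n.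
Proof.
apply: Rintegral_ge0 => x /=; rewrite in_itv/= andbT => x0.
exact/ltW/mellin_integrand_gt0.
Qed.

Lemma mellin_gt0 c n : n%:R < c -> 0 < mellin c n.
Proof.
move=> nc; apply: Rintegral_gt0; first exact: integrable_mellin.
by move=> x; exact: mellin_integrand_gt0.
Qed.

(** Dilation by [l] multiplies the Mellin integral by [l]^ (- c)[. Divided by]t[as]t[tends to 0, the
    identity becomes integration by parts of]x [^ c] against the derivative of
    [(exp_tail n x)^-1]. *)
Lemma mellin_dilation_sub c n t : n%:R < c ->
  let l := expR t in
  let f x := x `^ (c - 1) * ((exp_tail n x)^-1 - (exp_tail n (l * x))^-1) in
  mu.-integrable D (EFin \o f) /\
  \int[mu]_(x in D) f x = (1 - expR (- (c * t))) * mellin c n.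
Proof.
move=> nc l f; have l0 : 0 < l := expR_gt0 t.
have mi_ge0 x : 0 < x -> 0 <= mellin_integrand c n x.
  by move=> x0; exact/ltW/mellin_integrand_gt0.
have I1 := integrable_mellin nc.
have I2 := integrable_dilation l0 mi_ge0 I1.
(* The prefactor is [l]^ (1 - c)[; it cancels the power of]l[produced by the dilated integrand,
   leaving]x [^ (c - 1) / exp_tail n (l * x)] for [x > 0]. *)
pose g x := expR (t * (1 - c)) * mellin_integrand c n (l * x).
have I3 : mu.-integrable D (EFin \o g).
  rewrite (_ : EFin \o g = (fun x => (expR (t * (1 - c)))%:E *
      (EFin \o (fun x => mellin_integrand c n (l * x))) x)%E).
    by apply: integrableZl.
  by apply: funext => x /=; rewrite -EFinM.
have fE : {in D, f =1 (fun x => mellin_integrand c n x - g x)}.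
  move=> x /set_mem/=; rewrite in_itv/= andbT => x0.
  rewrite /f /g /mellin_integrand powRM ?(ltW l0) ?(ltW x0)//.
  rewrite /l -expRM -/l mulrBr !mulrA -expRD.
  by rewrite (_ : t * (1 - c) + t * (c - 1) = 0) ?expR0 ?mul1r//; ring.
split.
  apply: (@eq_integrable _ (measurableTypeR R) R mu D (measurable_itv _)
    (EFin \o (fun x => mellin_integrand c n x - g x))).
    by move=> x Dx; rewrite /= (fE _ Dx).
  rewrite (_ : EFin \o _ = (EFin \o mellin_integrand c n) \- (EFin \o g))%E.
    by apply: integrableB.
  by apply: funext => x /=; rewrite EFinB.
transitivity (\int[mu]_(x in D) (mellin_integrand c n x - g x)).
  exact: eq_Rintegral.
rewrite RintegralB// RintegralZl// Rintegral_dilation//.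
rewrite -/(mellin c n) mulrA /l -expRN -expRD.
rewrite (_ : t * (1 - c) + - t = - (c * t)); last by ring.
by rewrite mulrBl mul1r.
Qed.

(** Stands in for the limit as [t] tends to 0. *)
Lemma le0_of_small (d K e : R) : 0 <= K -> 0 < e ->
  (forall t, 0 < t -> t < e -> d <= t * K) -> d <= 0.
Proof.
move=> K0 e0 H; rewrite leNgt; apply/negP => d0.
have q0 : 0 < e * (K + 1) + d by rewrite addr_gt0// mulr_gt0// ltr_wpDl.
(* For [d > 0] this [t] is below [e], and [t * K < d] because [e * K < e * (K + 1) + d]. *)
have := H (e * d / (e * (K + 1) + d)).
rewrite divr_gt0 ?mulr_gt0// => /(_ isT).
rewrite ltr_pdivrMr// mulrAC ler_pdivlMr// ltr_pM2l//.
rewrite ltrDr mulr_gt0 ?ltr_wpDl// => /(_ isT).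
have := mulr_gt0 e0 d0; have := mulr_gt0 d0 d0; nra.
Qed.

Lemma mellin_shift_le c n : n.+1%:R < c ->
  c * mellin c n.+1 <= mellin (c + 1) n.+2.
Proof.
move=> nc; have c0 : 0 < c by apply: lt_trans nc; rewrite ltr0n.
set M := mellin c n.+1; set M' := mellin (c + 1) n.+2.
have M0 : 0 <= M := mellin_ge0 _ _; have M'0 : 0 <= M' := mellin_ge0 _ _.
(* The estimates below give [c * M * (1 - t) <= (1 + c * t) * M'], which rearranges to this
   constant; [t < 1] keeps [1 - t] positive. *)
rewrite -subr_le0; apply: (@le0_of_small _ (c * M + c * M') 1) => //.
  by rewrite addr_ge0// mulr_ge0// ltW.
move=> t t0 t1; have [If EI] := mellin_dilation_sub t nc.
have et1 : 1 < expR t by rewrite expR_gt1.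
have nc' : n.+2%:R < c + 1 by rewrite -natr1 ltrD2r.
have I' := integrable_mellin nc'.
have : (1 - expR (- (c * t))) * M <= (expR t - 1) * M'.
  rewrite -EI /M' /mellin -RintegralZl//; apply: le_Rintegral => //.
    rewrite (_ : EFin \o _ = (fun x => (expR t - 1)%:E *
      (EFin \o mellin_integrand (c + 1) n.+2) x)%E); first exact: integrableZl.
    by apply: funext => x /=; rewrite -EFinM.
  move=> x /=; rewrite in_itv/= andbT => x0.
  rewrite /mellin_integrand addrK -(mulr_powRB1 (ltW x0) c0).
  rewrite [leRHS](_ : _ = x `^ (c - 1) * ((expR t * x - x) / exp_tail n.+2 x)).
    by rewrite ler_wpM2l ?powR_ge0// inv_exp_tail_sub_le// ltr_pMl.
  ring.
have ct0 : 0 < c * t by rewrite mulr_gt0.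
have := expR_ge1Dx (c * t); have := expR_ge1Dx (- t).
rewrite !expRN; set p := expR t; set q := expR (c * t) => H1 H2.
have p0 : 0 < p := expR_gt0 _; have q0 : 0 < q := expR_gt0 _.
have p1 : (1 - t) * (p - 1) <= t.
  have : (1 - t) * p <= 1 by rewrite -ler_pdivlMr// mul1r.
  lra.
have q1 : c * t <= (1 + c * t) * (1 - q^-1).
  have : (1 + c * t) * q^-1 <= 1 by rewrite ler_pdivrMr// mul1r.
  lra.
move=> H.
(* [A], [B] and [C] chain together: [A] and [C] replace the exponentials by linear bounds, and [B]
   is the integrated inequality [H]. *)
have A : c * t * M * (1 - t) <= (1 + c * t) * (1 - q^-1) * M * (1 - t).
  by apply: ler_wpM2r; [lra|exact: ler_wpM2r].
have B : (1 + c * t) * (1 - t) * ((1 - q^-1) * M) <=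
    (1 + c * t) * (1 - t) * ((p - 1) * M').
  by apply: ler_wpM2l => //; rewrite mulr_ge0//; lra.
have C : (1 + c * t) * M' * ((1 - t) * (p - 1)) <= (1 + c * t) * M' * t.
  by apply: ler_wpM2l => //; rewrite mulr_ge0//; lra.
rewrite -(ler_pM2l t0); lra.
Qed.

(** Half of the functional equation of Gamma, obtained from [expRN_sub_ge] at [x] and its dilate by
    [expR t]. *)
Lemma mellin0_shift_ge c : 0 < c -> mellin (c + 1) 0 <= c * mellin c 0.
Proof.
move=> c0.
set M := mellin c 0; set M' := mellin (c + 1) 0.
have M0 : 0 <= M := mellin_ge0 _ _; have M'0 : 0 <= M' := mellin_ge0 _ _.
(* Here the final estimate is [(1 - c * t) * M' <= (1 + t) * (c * M)]; [t < c^-1] keeps [1 - c * t]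
   positive. *)
rewrite -subr_le0; apply: (@le0_of_small _ (c * M + c * M') c^-1).
- by rewrite addr_ge0// mulr_ge0// ltW.
- by rewrite invr_gt0.
move=> t t0 tc; have [If EI] := @mellin_dilation_sub c 0 t c0.
have et0 : 0 < expR t := expR_gt0 t.
have et1 : 1 < expR t by rewrite expR_gt1.
have I' : mu.-integrable D (EFin \o mellin_integrand (c + 1) 0).
  by apply: integrable_mellin; rewrite addr_gt0.
have mi_ge0 x : 0 < x -> 0 <= mellin_integrand (c + 1) 0 x.
  by move=> x0; exact/ltW/mellin_integrand_gt0.
have I2 := integrable_dilation et0 mi_ge0 I'.
(* The lower bound is evaluated at the dilated point: [(expR t)^-1 * M'] integrates the dilated
   integrand, and [expR (- (c * t))] removes the power of [expR t] it contains. *)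
have : (expR t - 1) * expR (- (c * t)) * ((expR t)^-1 * M') <=
       (1 - expR (- (c * t))) * M.
  rewrite -EI /M' /mellin -Rintegral_dilation// -RintegralZl//.
  apply: le_Rintegral => //.
    rewrite (_ : EFin \o _ = (fun x => ((expR t - 1) * expR (- (c * t)))%:E *
      (EFin \o (fun x => mellin_integrand (c + 1) 0 (expR t * x))) x)%E).
      exact: integrableZl.
    by apply: funext => x /=; rewrite -EFinM.
  move=> x /=; rewrite in_itv/= andbT => x0.
  rewrite /mellin_integrand addrK powRM ?(ltW x0) ?(ltW et0)// -expRM.
  rewrite -(mulr_powRB1 (ltW x0) c0) !exp_tail0 -!expRN.
  rewrite [leLHS](_ : _ = expR (- (c * t)) * expR (t * c) * (x `^ (c - 1) *
    ((expR t * x - x) * expR (- (expR t * x))))); last by ring.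
  rewrite -expRD [t * c]mulrC addNr expR0 mul1r.
  by rewrite ler_wpM2l ?powR_ge0// expRN_sub_ge.
have ct0 : 0 < c * t by rewrite mulr_gt0.
have ct1 : c * t < 1 by rewrite -ltr_pdivlMl// mulr1.
have := expR_ge1Dx (- (c * t)); have := expR_ge1Dx t.
rewrite !expRN; set p := expR t; set q := expR (c * t) => H1 H2.
have p0 : 0 < p := et0; have q0 : 0 < q := expR_gt0 _.
rewrite -(ler_pM2r q0).
rewrite [leLHS](_ : _ = (1 - p^-1) * M'); last by field; rewrite !gt_eqF.
rewrite [leRHS](_ : _ = (q - 1) * M); last by field; rewrite !gt_eqF.
move=> H.
have p1 : t <= (1 + t) * (1 - p^-1).
  have : (1 + t) * p^-1 <= 1 by rewrite ler_pdivrMr// mul1r.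
  lra.
have q1 : (1 - c * t) * (q - 1) <= c * t.
  have : (1 - c * t) * q <= 1 by rewrite -ler_pdivlMr// mul1r.
  lra.
have A : t * ((1 - c * t) * M') <= (1 + t) * (1 - p^-1) * ((1 - c * t) * M').
  by apply: ler_wpM2r => //; rewrite mulr_ge0//; lra.
have B : (1 + t) * (1 - c * t) * ((1 - p^-1) * M') <=
    (1 + t) * (1 - c * t) * ((q - 1) * M).
  by apply: ler_wpM2l => //; rewrite mulr_ge0//; lra.
have C : (1 + t) * M * ((1 - c * t) * (q - 1)) <= (1 + t) * M * (c * t).
  by apply: ler_wpM2l => //; rewrite mulr_ge0//; lra.
rewrite -(ler_pM2l t0); lra.
Qed.

End mellin_shift.

(** * Comparison with the Dirichlet series, and monotonicity in the order *)

Section zeta_comparison.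
Context {R : realType}.
Local Notation mu := (@lebesgue_measure R).
Local Notation D := (`]0, +oo[%classic : set R).
Implicit Types (c s t x y l : R) (n m : nat).

(** With [q = expR (- x)], the right side is the full sum [q / (1 - q) ^+ 2] of the series of
    [k * q ^+ k]; [H] gives the partial sums in closed form with a nonnegative defect. *)
Lemma sum_expRN_le x m : 0 < x ->
  \sum_(0 <= k < m) k.+1%:R * expR (- (k.+1%:R * x)) <= expR x / (expR x - 1) ^+ 2.
Proof.
move=> x0; have E1 : 1 < expR x by rewrite expR_gt1.
have E0 : 0 < expR x := expR_gt0 x; set q := (expR x)^-1.
have q0 : 0 < q by rewrite invr_gt0.
have q1 : q < 1 by rewrite invf_lt1.
have H : (1 - q) ^+ 2 * \sum_(0 <= k < m) k.+1%:R * q ^+ k.+1 =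
    q * (1 - q ^+ m * (1 + m%:R * (1 - q))).
  elim: m => [|m IH]; first by rewrite big_nil expr0; ring.
  by rewrite big_nat_recr//= mulrDr IH !exprS -natr1; ring.
under eq_bigr => k _ do rewrite -mulrN expRM_natl expRN -/q.
have -> : expR x / (expR x - 1) ^+ 2 = q / (1 - q) ^+ 2.
  by rewrite /q; field; rewrite subr_eq0 !gt_eqF.
rewrite ler_pdivlMr ?exprn_gt0 ?subr_gt0// mulrC H ger_pMr// gerBl.
by rewrite mulr_ge0 ?exprn_ge0 ?(ltW q0)// addr_ge0// mulr_ge0// subr_ge0 ltW.
Qed.

(** Cross-multiplying with [exp_tail 2 x = expR x - 1 - x] reduces the claim to
    [1 - x < expR (- x)]. *)
Lemma expR_quotient_lt x : 0 < x ->
  expR x / (expR x - 1) ^+ 2 < (exp_tail 2 x)^-1.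
Proof.
move=> x0; have E1 : 1 < expR x by rewrite expR_gt1.
have t0 := exp_tail_gt0 2 x0.
rewrite ltr_pdivrMr ?exprn_gt0 ?subr_gt0// mulrC ltr_pdivlMr//.
have : expR x * (1 - x) < 1.
  rewrite mulrC -ltr_pdivlMr ?expR_gt0// mul1r -expRN.
  by rewrite expR_gt1Dx// oppr_eq0 gt_eqF.
rewrite /exp_tail big_nat_recr//= big_nat1 /exp_term/= expr0 expr1 fact0.
rewrite (_ : 1`! = 1%N)// !divr1; lra.
Qed.

Lemma zeta_mul_Gamma_lt s : 1 < s -> zeta s * Gamma (s + 1) < mellin (s + 1) 2.
Proof.
move=> s1; have s0 : 0 < s by lra.
have s10 : 0 < s + 1 by lra.
have I0 : mu.-integrable D (EFin \o mellin_integrand (s + 1) 0).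
  exact: integrable_mellin.
have I2 : mu.-integrable D (EFin \o mellin_integrand (s + 1) 2).
  by apply: integrable_mellin; lra.
pose h x := x `^ s * (expR x / (expR x - 1) ^+ 2).
have E1 x : 0 < x -> 0 < expR x - 1 by move=> x0; rewrite subr_gt0 expR_gt1.
have h0 x : 0 <= h x.
  by rewrite mulr_ge0 ?powR_ge0// divr_ge0 ?expR_ge0// sqr_ge0.
have hlt x : 0 < x -> h x < mellin_integrand (s + 1) 2 x.
  move=> x0; rewrite /mellin_integrand addrK ltr_pM2l ?powR_gt0//.
  exact: expR_quotient_lt.
have Ih : mu.-integrable D (EFin \o h).
  apply: (@le_integrable _ (measurableTypeR R) R mu D (measurable_itv _)
    (EFin \o h) (EFin \o mellin_integrand (s + 1) 2)) => //.
    apply/measurable_EFinP; apply: measurable_continuous_half_line => x x0.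
    apply: continuousM; first exact: continuous_powR.
    apply: continuousM; first exact: continuous_expR.
    apply: continuousV; first by rewrite gt_eqF// exprn_gt0// E1.
    have cE : {for x, continuous (fun y : R => expR y - 1)}.
      by apply: continuousB; [exact: continuous_expR|exact: cst_continuous].
    exact: (continuousM cE cE).
  move=> x /=; rewrite in_itv/= andbT => x0.
  by rewrite lee_fin !ger0_norm ?(ltW (hlt _ x0))// ltW// mellin_integrand_gt0.
(* Strictness is secured here, before the limit: every partial sum of the series will be bounded by
   the fixed integral of [h]. *)
have hM : \int[mu]_(x in D) h x < mellin (s + 1) 2.
  rewrite -subr_gt0 /mellin -RintegralB//; apply: Rintegral_gt0.
    rewrite (_ : EFin \o _ = (EFin \o mellin_integrand (s + 1) 2) \- (EFin \o h))%E.
      exact: integrableB.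
    by apply: funext => x /=; rewrite EFinB.
  by move=> x x0; rewrite subr_gt0 hlt.
have mi_ge0 x : 0 < x -> 0 <= mellin_integrand (s + 1) 0 x.
  by move=> x0; exact/ltW/mellin_integrand_gt0.
pose e k x := x `^ s * (k.+1%:R * expR (- (k.+1%:R * x))).
(* Dilation by [k.+1%:R] will contribute a further factor [k.+1%:R^-1], turning the exponent [1 - s]
   into the [- s] of the Dirichlet series. *)
have eE k : {in D, e k =1
    (fun x => k.+1%:R `^ (1 - s) * mellin_integrand (s + 1) 0 (k.+1%:R * x))}.
  move=> x /set_mem/=; rewrite in_itv/= andbT => x0; rewrite /e.
  rewrite /mellin_integrand addrK powRM ?(ltW x0)// exp_tail0 -expRN !mulrA.
  rewrite -powRD ?pnatr_eq0 ?implybT// subrK powRr1//; ring.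
have Ie' k : mu.-integrable D (EFin \o (fun x =>
    k.+1%:R `^ (1 - s) * mellin_integrand (s + 1) 0 (k.+1%:R * x))).
  have k0 : 0 < k.+1%:R :> R by [].
  have Ik := integrable_dilation k0 mi_ge0 I0.
  rewrite (_ : EFin \o _ = (fun x => (k.+1%:R `^ (1 - s))%:E *
    (EFin \o (fun x => mellin_integrand (s + 1) 0 (k.+1%:R * x))) x)%E).
    exact: integrableZl.
  by apply: funext => x /=; rewrite -EFinM.
have Ie k : mu.-integrable D (EFin \o e k).
  apply: (@eq_integrable _ (measurableTypeR R) R mu D (measurable_itv _)
    _ _ _ (Ie' k)).
  by move=> x Dx; rewrite /= (eE _ _ Dx).
have int_e k : \int[mu]_(x in D) e k x = (k.+1%:R `^ s)^-1 * Gamma (s + 1).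
  transitivity (\int[mu]_(x in D)
      (k.+1%:R `^ (1 - s) * mellin_integrand (s + 1) 0 (k.+1%:R * x))).
    exact: eq_Rintegral.
  have k0 : 0 < k.+1%:R :> R by [].
  rewrite RintegralZl//; last exact: integrable_dilation.
  rewrite Rintegral_dilation// Gamma_mellin mulrA -powRN; congr *%R.
  rewrite -(powR_inv1 (ltW k0)) -powRD ?pnatr_eq0 ?implybT//; congr powR; ring.
pose S m x := \sum_(0 <= k < m) e k x.
have HS m : mu.-integrable D (EFin \o S m) /\
    \int[mu]_(x in D) S m x =
    series (fun n : nat => (n.+1%:R `^ s)^-1) m * Gamma (s + 1).
  elim: m => [|m [IS ES]].
    have -> : S 0 = cst 0 by apply: funext => x; rewrite /S big_nil.
    split; first exact: integrable0.
    by rewrite /series/= big_nil mul0r Rintegral_cst//= mul0r.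
  have -> : S m.+1 = (fun x => S m x + e m x).
    by apply: funext => x; rewrite /S big_nat_recr.
  split.
    rewrite (_ : EFin \o _ = (EFin \o S m) \+ (EFin \o e m))%E.
      exact: integrableD.
    by apply: funext => x /=; rewrite EFinD.
  by rewrite RintegralD// ES int_e /series/= big_nat_recr//= mulrDl.
have G0 : 0 < Gamma (s + 1) by rewrite Gamma_mellin mellin_gt0.
have bound m : series (fun n : nat => (n.+1%:R `^ s)^-1) m <=
    \int[mu]_(x in D) h x / Gamma (s + 1).
  have [IS ES] := HS m; rewrite ler_pdivlMr// -ES; apply: le_Rintegral => //.
  move=> x /=; rewrite in_itv/= andbT => x0.
  by rewrite /S /e -mulr_sumr ler_wpM2l ?powR_ge0// sum_expRN_le.
apply: le_lt_trans hM; rewrite -ler_pdivlMr// /zeta; apply: limr_le.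
  (* Convergence comes first, so that [limn] is a genuine limit: the partial sums increase and are
     bounded. *)
  apply: nondecreasing_is_cvgn.
    apply: nondecreasing_series => n _ _.
    by rewrite invr_ge0 powR_ge0.
  by exists (\int[mu]_(x in D) h x / Gamma (s + 1)) => _ [m _ <-].
by apply: nearW => m; exact: bound.
Qed.

Lemma hyper_zeta_mellin n s :
  hyper_zeta n.+1 s = (mellin (s + n%:R) 0)^-1 * mellin (s + n%:R) n.+1.
Proof.
rewrite /hyper_zeta Gamma_mellin -natr1 addrA addrK; congr (_ * _).
apply: eq_Rintegral => x _; rewrite /mellin_integrand /taylor_exp /exp_tail.
by congr (x `^ _ / _); ring.
Qed.

(** Both shift inequalities enter with [c = s + n%:R]; the factor [c] that each of them carries
    cancels in the quotient of Mellin integrals. *)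
Lemma hyper_zeta_leS n s : 1 < s -> hyper_zeta n.+1 s <= hyper_zeta n.+2 s.
Proof.
move=> s1; have n0 : 0 <= n%:R :> R by [].
rewrite !hyper_zeta_mellin -natr1 addrA; set c := s + n%:R.
have nc : n.+1%:R < c by rewrite /c -natr1 addrC ltrD2r.
have c0 : 0 < c by apply: lt_trans nc.
have G0 : 0 < mellin c 0 by rewrite mellin_gt0.
have G1 : 0 < mellin (c + 1) 0 by rewrite mellin_gt0// addr_gt0.
rewrite ler_pdivrMl// mulrCA ler_pdivlMl// -(ler_pM2l c0) !mulrA.
apply: (@le_trans _ _ (mellin (c + 1) 0 * mellin (c + 1) n.+2)).
  by rewrite [c * _]mulrC -mulrA ler_wpM2l ?(ltW G1)// mellin_shift_le.
by rewrite ler_wpM2r ?mellin_ge0// mellin0_shift_ge.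
Qed.

Lemma zeta_lt_hyper_zeta2 s : 1 < s -> zeta s < hyper_zeta 2 s.
Proof.
move=> s1; rewrite hyper_zeta_mellin -Gamma_mellin ltr_pdivlMl.
  by rewrite mulrC zeta_mul_Gamma_lt.
by rewrite Gamma_mellin mellin_gt0//; lra.
Qed.

End zeta_comparison.

Theorem theorem2p1 (R : realType) (N : nat) (sigma : R) :
  (1 < N)%N -> 1 < sigma -> zeta sigma < hyper_zeta N sigma.
Proof.
case: N => [|[|n]]// _ s1; apply: lt_le_trans (zeta_lt_hyper_zeta2 s1) _.
by elim: n => [//|n]; move=> /le_trans; apply; exact: hyper_zeta_leS.
Qed.
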